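(* Let $D$ be a natural number, let $X$ be a compact metrizable space, let $T:\mathbb{R}^D\times X\to X$ be a continuous action of the group $\mathbb{R}^D$ on $X$, and let $d$ be a metric on $X$ compatible with the topology. For any $\delta>0$, \[ \overline{\mathrm{mdim}}_M(X,T,d)=\limsup_{\varepsilon\to 0}\frac{\sup_{x\in X}S\left(B_\delta(x,d_{\mathbb{R}^D}),\varepsilon\right)}{\log(1/\varepsilon)}, \] \[ \underline{\mathrm{mdim}}_M(X,T,d)=\liminf_{\varepsilon\to 0}\frac{\sup_{x\in X}S\left(B_\delta(x,d_{\mathbb{R}^D}),\varepsilon\right)}{\log(1/\varepsilon)}. \]
   Context: $\mathbb{R}^D$ has the standard topology, and $T^ax:=T(a,x)$ for $a\in\mathbb{R}^D$, $x\in X$. Spanning numbers: for a metric $\rho$ on $X$, $\varepsilon>0$ and $K\subset X$, a subset $E\subset X$ is a $(\rho,\varepsilon)$-spanning set of $K$ if for every $x\in K$ there is $y\in E$ with $\rho(x,y)\le\varepsilon$ (points of $E$ need not lie in $K$). $\#(K,\rho,\varepsilon)$ denotes the minimum cardinality of such $E$. For $\Omega\subset\mathbb{R}^D$ put $d_\Omega(x,y):=\sup_{a\in\Omega}d(T^ax,T^ay)$. For $\varepsilon>0$ and $K\subset X$, the entropy of $K$ at the scale $\varepsilon$ is \[S(K,\varepsilon):=\limsup_{L\to\infty}\frac{1}{L^D}\log\#\left(K,d_{[0,L]^D},\varepsilon\right).\] The upper and lower metric mean dimensions are \[\overline{\mathrm{mdim}}_M(X,T,d):=\limsup_{\varepsilon\to0}\frac{S(X,\varepsilon)}{\log(1/\varepsilon)},\qquad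 \underline{\mathrm{mdim}}_M(X,T,d):=\liminf_{\varepsilon\to0}\frac{S(X,\varepsilon)}{\log(1/\varepsilon)}.\] For $x\in X$, $\delta>0$ and $\Omega\subset\mathbb{R}^D$, $B_\delta(x,d_\Omega):=\{y\in X\mid d_\Omega(x,y)\le\delta\}$. Thus $B_\delta(x,d_{\mathbb{R}^D})=\{y\in X\mid d(T^ax,T^ay)\le\delta\text{ for all }a\in\mathbb{R}^D\}$. *)

(* Defs.v *)
From HB Require Import structures.
From mathcomp Require Import all_boot all_order all_algebra finmap.
From mathcomp Require Import all_classical all_reals all_analysis.

Set Implicit Arguments.
Unset Strict Implicit.
Unset Printing Implicit Defensive.

Import Order.TTheory GRing.Theory Num.Theory.
Import numFieldNormedType.Exports.

Local Open Scope classical_set_scope.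
Local Open Scope ring_scope.

(* R^D is 'rV[R]_D with its additive group structure and product topology. *)
Record continuous_action (R : realType) (D : nat) (X : topologicalType)
    (T : 'rV[R]_D -> X -> X) : Prop := {
  act0 : forall x, T 0 x = x ;
  actD : forall a b x, T (a + b) x = T a (T b x) ;
  act_continuous : continuous (fun p : 'rV[R]_D * X => T p.1 p.2) }.

Definition cube (R : realType) (D : nat) (L : R) : set 'rV[R]_D :=
  [set a : 'rV[R]_D | forall i, 0 <= a ord0 i <= L].

(* The points of E need not lie in K. *)
Definition spanning (R : realType) (X : Type) (rho : X -> X -> R) (eps : R)
    (K E : set X) : Prop :=
  forall x, K x -> exists2 y, E y & rho x y <= eps.

(* Least cardinality of a finite spanning set, +oo if there is none;
   the value is 0 when K is empty. *)
Definition span_num (R : realType) (X : choiceType) (K : set X)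
    (rho : X -> X -> R) (eps : R) : \bar R :=
  ereal_inf [set (#|` E|%:R)%:E | E in
    [set E : {fset X} | spanning rho eps K [set` E]]].

Section MeanDimension.
Context {R : realType} {D : nat} {X : metricType R} (T : 'rV[R]_D -> X -> X).

(* On a compact X the metric is bounded, so this real supremum is a genuine
   one as soon as Omega is nonempty. *)
Definition dist_on (Omega : set 'rV[R]_D) (x y : X) : R :=
  sup [set mdist (T a x) (T a y) | a in Omega].

Definition dyn_ball (delta : R) (x : X) (Omega : set 'rV[R]_D) : set X :=
  [set y | dist_on Omega x y <= delta].

(* lne 0 = -oo, so the entropy of the empty set is -oo. *)
Definition entropy (K : set X) (eps : R) : \bar R :=
  limf_esup (fun L : R =>
    lne (span_num K (dist_on (cube L)) eps) / (L ^+ D)%:E)%E +oo.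

Definition upper_mdim : \bar R :=
  limf_esup (fun eps : R =>
    entropy [set: X] eps / (ln (1 / eps))%:E)%E 0^'+.

Definition lower_mdim : \bar R :=
  limf_einf (fun eps : R =>
    entropy [set: X] eps / (ln (1 / eps))%:E)%E 0^'+.

End MeanDimension.

(* Main.v *)
(* Monotonicity gives one inequality. For the other one, it suffices to show
   S(X, 4 eps) <= S(X, delta) + sup_x S(B_delta(x), eps), with S(X, delta) finite:
   the constant term and the factor 4 disappear after division by log(1/eps).
   As in Bowen's argument, this reduces to a bound, uniform in x, of the spanning
   numbers of the finite-time balls B_delta(x, d_[0,L]^D) by exp((h + beta) L^D),
   where h bounds all the S(B_delta(y), eps). If it fails for cubes of side L_n
   around x_n, submultiplicativity over tilings by cubes of side m, averaged over
   the positions of the tiling, makes the set of lattice translates of x_n that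
   are bad at scale m of density at least c, with c independent of m. By Ptak's
   combinatorial lemma there are infinitely many scales of which any finitely
   many are simultaneously bad for some translate; by compactness, some y is bad
   at infinitely many scales, which contradicts S(B_delta(y), eps) <= h. *)
Require Import Defs.
From HB Require Import structures.
From mathcomp Require Import all_boot all_order all_algebra finmap.
From mathcomp Require Import all_classical all_reals all_analysis.
Import Order.TTheory GRing.Theory Num.Theory.
Import numFieldNormedType.Exports.
Local Open Scope classical_set_scope.
Local Open Scope ring_scope.
From mathcomp Require Import lra ring zify.

(** * Elementary counting and limits at infinity *)

Section Elementary.
Set Implicit Arguments.
Unset Strict Implicit.
Context {R : realType}.

Lemma card_ord_itv b l u : (u < b)%N ->
  (u.+1 - l <= #|[set k : 'I_b | (l <= k <= u)%N]%SET|)%N.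
Proof.
move=> ub; pose f (k : 'I_(u.+1 - l)) : 'I_b := insubd (Ordinal ub) (l + k)%N.
have fE (k : 'I_(u.+1 - l)) : f k = (l + k)%N :> nat.
  by rewrite /f val_insubd; have := ltn_ord k; case: ifP => //; lia.
have f_inj : injective f.
  by move=> k1 k2 /(congr1 val); rewrite /= !fE => /addnI/val_inj.
rewrite -[X in (X <= _)%N]card_ord -(card_codom f_inj) subset_leq_card//.
apply/fintype.subsetP => _ /codomP[k ->]; rewrite inE fE.
by have := ltn_ord k; lia.
Qed.

Lemma bernoulli (x : R) n : 0 <= x <= 1 -> 1 - n%:R * x <= (1 - x) ^+ n.
Proof.
move=> /andP[x0 x1]; elim: n => [|d IHd]; first by rewrite mul0r subr0.
rewrite exprS (le_trans _ (ler_wpM2l _ IHd)) ?subr_ge0// -natr1.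
rewrite [leRHS](_ : _ = 1 - (d%:R + 1) * x + d%:R * x ^+ 2); last by ring.
by rewrite lerDl mulr_ge0// sqr_ge0.
Qed.

Lemma near_pinfty_contra (P : R -> Prop) :
  (forall M, exists2 L, M <= L & ~ P L) \/ (\forall L \near +oo, P L).
Proof.
have [H|/existsNP[M HM]] := pselect (forall M, exists2 L, M <= L & ~ P L).
  by left.
right; have : \forall L \near +oo, M <= L by apply: nbhs_pinfty_ge; rewrite num_real.
by apply: filterS => L ML; apply: contrapT => nPL; apply: HM; exists L.
Qed.

Lemma near_pinfty_nat (P : R -> Prop) :
  (\forall L \near +oo, P L) -> \forall m \near \oo, P m%:R.
Proof.
move=> [M [_ MP]]; exists (Num.truncn M).+1 => // m /= Mm; apply: MP.
by apply: lt_le_trans (truncnS_gt _) _; rewrite ler_nat.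
Qed.

End Elementary.

(** * Spanning sets for orbits observed over a set of times *)

Section Spanning.
Set Implicit Arguments.
Unset Strict Implicit.
Context {R : realType} {D : nat} {X : metricType R} (T : 'rV[R]_D -> X -> X).
Implicit Types (K : set X) (Q : set 'rV[R]_D) (eps : R) (k : nat).

(** Closeness is required time by time rather than through [dist_on], whose real supremum takes a
    default value on an empty or unbounded set. *)
Definition spans K Q eps k := exists E : seq X, (size E <= k)%N /\
  forall x, K x -> exists2 y, y \in E &
    forall a, Q a -> mdist (T a x) (T a y) <= eps.

Definition orbit_ball (x : X) Q (delta : R) : set X :=
  [set y | forall a, Q a -> mdist (T a x) (T a y) <= delta].

Lemma spans_leq K Q eps k k' : (k <= k')%N -> spans K Q eps k -> spans K Q eps k'.
Proof. by move=> kk' [E [Ek EK]]; exists E; split=> //; exact: leq_trans kk'. Qed.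

Lemma sub_spans K K' Q Q' eps k : K `<=` K' -> Q `<=` Q' ->
  spans K' Q' eps k -> spans K Q eps k.
Proof.
move=> KK' QQ' [E [Ek EK]]; exists E; split=> // x /KK' /EK[y yE xy].
by exists y => // a /QQ'; exact: xy.
Qed.

(** Bowen's covering step: each point lies in the ball around some point of [E], and the lists
    spanning these balls are concatenated. *)
Lemma spans_orbit_balls Q eps delta k l : spans setT Q delta k ->
  (forall x, spans (orbit_ball x Q delta) Q eps l) -> spans setT Q eps (k * l).
Proof.
move=> [E [Ek EX]] /choice[F FP].
exists (flatten [seq F e | e <- E]); split.
  have El : (size (flatten [seq F e | e <- E]) <= size E * l)%N.
    rewrite size_flatten /shape -map_comp; elim: (E) => //= e s IHs.
    by rewrite mulSn leq_add// (FP e).1.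
  by rewrite (leq_trans El)// leq_mul2r Ek orbT.
move=> x _; have [y yE xy] := EX x I.
have [|z zF xz] := (FP y).2 x; first by move=> a Qa; rewrite metric_sym xy.
by exists z => //; apply/flatten_mapP; exists y.
Qed.

(* The scale doubles because a center has to be chosen inside each intersection
   of balls, one ball per [i]. *)
Lemma spans_prod (J : eqType) (I : seq J) (Qs : J -> set 'rV[R]_D) K Q eps
    (k : J -> nat) :
  (forall a, Q a -> exists2 i, i \in I & Qs i a) ->
  (forall i, i \in I -> spans K (Qs i) eps (k i)) ->
  spans K Q (2 * eps) (\prod_(i <- I) k i).
Proof.
move=> QI IK.
(* The members of [s] are the intersections of one ball per index; two points of the same cell are
   compared through the common center of each ball. *)
have [s [sk sK sI]] : exists s : seq (set X),
    [/\ (size s <= \prod_(i <- I) k i)%N,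
        forall x, K x -> exists2 A, A \in s & A x &
        forall A, A \in s -> forall x y, A x -> A y ->
          forall i, i \in I -> forall a, Qs i a ->
          mdist (T a x) (T a y) <= 2 * eps].
  elim: I {QI} IK => [_|i I IHI IK].
    by exists [:: setT]; rewrite big_nil; split=> // x _; exists setT; rewrite ?inE.
  have [|s [sk sK sI]] := IHI; first by move=> j jI; apply: IK; rewrite inE jI orbT.
  have [|E [Ek EK]] := IK i; first by rewrite inE eqxx.
  pose P e := [set x | forall a, Qs i a -> mdist (T a x) (T a e) <= eps].
  exists [seq P e `&` A | e <- E, A <- s]; split.
  - by rewrite size_allpairs big_cons leq_mul.
  - move=> x Kx; have [e eE xe] := EK x Kx; have [A As Ax] := sK x Kx.
    by exists (P e `&` A) => //; apply: allpairs_f.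
  - move=> _ /allpairsP[[e A]/= [eE As ->]] x y [xe Ax] [ye Ay] j.
    rewrite inE => /predU1P[-> a Qa|jI]; last exact: (sI A As).
    rewrite (le_trans (metric_triangle _ (T a e) _))// mulr_natl mulr2n.
    by apply: lerD; [exact: xe|rewrite metric_sym; exact: ye].
have [K0|/set0P[x0 Kx0]] := eqVneq K set0.
  by exists [::]; split=> // x; rewrite K0.
(* The default [x0] is taken only on empty cells, which cover no point. *)
exists [seq xget x0 A | A <- s]; split; first by rewrite size_map.
move=> x Kx; have [A As Ax] := sK x Kx.
exists (xget x0 A); first exact: map_f.
move=> a /QI[i iI Qia]; apply: (sI A As _ _ Ax _ i iI a Qia).
by apply: xgetPex; exists x.
Qed.

End Spanning.

(** * Consequences of compactness and of joint continuity of the action *)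

Section Compactness.
Set Implicit Arguments.
Unset Strict Implicit.
Context {R : realType} {D : nat} {X : metricType R} (T : 'rV[R]_D -> X -> X).
Hypotheses (compactX : compact [set: X]) (actT : continuous_action T).

Lemma cube_compact (L : R) : compact (@cube R D L).
Proof.
rewrite (_ : cube L = [set v : 'rV[R]_D | forall i, `[0, L]%classic (v ord0 i)]).
  by apply: (@rV_compact R D (fun=> `[0, L]%classic)) => i; exact: segment_compact.
by apply/seteqP; split=> v vL i; have := vL i; rewrite /= in_itv.
Qed.

Lemma action_near (a : 'rV[R]_D) (x : X) (eps : R) : 0 < eps ->
  \forall a' \near a & x' \near x, mdist (T a x) (T a' x') < eps.
Proof.
move=> eps0; have cT : (fun p : 'rV[R]_D * X => T p.1 p.2) @ (a, x) --> T a x.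
  exact: (@act_continuous _ _ _ _ actT (a, x)).
exact: (metricType_numDomainType.cvgr_dist_lt cT eps0).
Qed.

(** Joint continuity gives a neighborhood of [x] for times near each [a]; compactness of [Q] makes
    it uniform in time. *)
Lemma orbit_near (Q : set 'rV[R]_D) (x : X) (eps : R) : compact Q -> 0 < eps ->
  \forall x' \near x, forall a, Q a -> mdist (T a x) (T a x') < eps.
Proof.
move=> /compact_near_coveringP cQ eps0; apply: (cQ _ (nbhs x)) => a Qa.
have eps20 : 0 < eps / 2 by rewrite divr_gt0.
have [[/= U V] [aU xV] UV] := action_near a x eps20.
exists (U, V) => // -[a' x'] /= [Ua' Vx'].
rewrite (le_lt_trans (metric_triangle _ (T a x) _))// [ltRHS]splitr ltrD//.
  by rewrite metric_sym; apply: (UV (a', x)); split=> //; exact: nbhs_singleton.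
exact: (UV (a', x')).
Qed.

Lemma spans_exists (Q : set 'rV[R]_D) (eps : R) :
  compact Q -> 0 < eps -> exists k, spans T setT Q eps k.
Proof.
move=> cQ eps0.
(* A property holds eventually along [F] when it holds for all lists containing some fixed list;
   near-covering compactness then produces one list of centers. *)
pose F : set_system (seq X) := filter_from setT (fun E0 : seq X =>
  [set E : seq X | {subset E0 <= E}]).
have FF : ProperFilter F.
  apply: filter_from_proper => [|E0 _]; last by exists E0.
  apply: filter_from_filter; first by exists [::].
  by move=> E1 E2 _ _; exists (E1 ++ E2) => // E E12; split=> x xE;
    apply: E12; rewrite mem_cat xE ?orbT.
have : \forall E \near F, [set: X] `<=` [set x | exists2 y, y \in E &
    forall a, Q a -> mdist (T a x) (T a y) <= eps].
  move/compact_near_coveringP : compactX; apply => x _.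
  exists ([set x' | forall a, Q a -> mdist (T a x) (T a x') < eps],
    [set E : seq X | {subset [:: x] <= E}]);
    first by split; [exact: orbit_near|exists [:: x]].
  move=> [x' E]/= [xx' xE]; exists x; first by apply: xE; rewrite inE.
  by move=> a Qa; rewrite metric_sym ltW// xx'.
move=> H; have [E EX] := @filter_ex _ F _ _ H.
by exists (size E), E; split=> // x _; exact: EX.
Qed.

Lemma mdist_bounded : exists M, forall x y : X, mdist x y <= M.
Proof.
have [X0|/set0P[x0 _]] := eqVneq [set: X] set0.
  by exists 0 => x; have : [set: X] x by []; rewrite X0.
have : \forall r \near +oo, [set: X] `<=` [set x | mdist x0 x <= r].
  move/compact_near_coveringP : compactX; apply => x _.
  exists ([set x' | mdist x x' < 1], [set r | mdist x0 x + 1 <= r]).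
    split=> /=; last by apply: nbhs_pinfty_ge; rewrite num_real.
    by apply/metricType_numDomainType.nbhs_mdistP; exists 1 => //=.
  move=> [x' r] /= [xx' xr]; rewrite (le_trans _ xr)//.
  by rewrite (le_trans (metric_triangle _ x _))// lerD2l ltW.
move=> H; have [r rX] := @filter_ex _ +oo _ _ H.
exists (r + r) => x y.
rewrite (le_trans (metric_triangle _ x0 _))// lerD//; last exact: rX.
by rewrite metric_sym; exact: rX.
Qed.

(** Distances are bounded and [Q] is nonempty, so the real [sup] is a genuine least upper bound. *)
Lemma dist_onP (Q : set 'rV[R]_D) (Q0 : Q !=set0) (x y : X) (r : R) :
  (dist_on T Q x y <= r) <-> (forall a, Q a -> mdist (T a x) (T a y) <= r).
Proof.
have [M XM] := mdist_bounded; have [a0 Qa0] := Q0.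
rewrite /dist_on; split=> [xy a Qa|xy].
  apply: le_trans xy; apply: ub_le_sup; last by exists a.
  by exists M => _ [b _ <-].
apply: ge_sup; first by exists (mdist (T a0 x) (T a0 y)), a0.
by move=> _ [a Qa <-]; exact: xy.
Qed.

Definition window (n : nat) : set 'rV[R]_D :=
  [set a | forall i, `|a ord0 i| <= n%:R].

(** A point in the infinite-time ball of [y] is spanned, and so are its neighbors at twice the
    scale. A point outside violates the ball condition at a single time, which belongs to all large
    windows, and the violation persists nearby. Compactness of [X] makes both uniform. *)
Lemma spans_orbit_ball_near (y : X) (Q : set 'rV[R]_D) (eps delta : R)
    (k : nat) : compact Q -> 0 < eps ->
  spans T (orbit_ball T y setT delta) Q eps k ->
  \forall z \near y & n \near \oo,
    spans T (orbit_ball T z (window n) delta) Q (2 * eps) k.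
Proof.
move=> cQ eps0 [E [Ek EB]].
pose P (p : X * nat) w := orbit_ball T p.1 (window p.2) delta w ->
  exists2 e, e \in E & forall a, Q a -> mdist (T a w) (T a e) <= 2 * eps.
suff : \forall p \near filter_prod (nbhs y) \oo, [set: X] `<=` P p.
  by apply: filterS => -[z n] /= Pzn; exists E; split=> // w; exact: Pzn.
move/compact_near_coveringP : compactX; apply => w _.
have [/EB[e eE we]|] := pselect (orbit_ball T y setT delta w).
  exists ([set w' | forall a, Q a -> mdist (T a w) (T a w') < eps], setT).
    by split; [exact: orbit_near|exact: filterT].
  move=> [w' p] /= [ww' _] _; exists e => // a Qa.
  rewrite (le_trans (metric_triangle _ (T a w) _))// mulr_natl mulr2n lerD ?we//.
  by rewrite metric_sym ltW// ww'.
move=> /existsNP[a /not_implyP[_ /negP]]; rewrite -ltNge => yw.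
(* Half of the excess over [delta]: the images of [y] and [w] at time [a] may each move by less than
   [r] without ending the violation. *)
pose r := (mdist (T a y) (T a w) - delta) / 2.
have r0 : 0 < r by rewrite divr_gt0// subr_gt0.
have near_a x : \forall x' \near x, mdist (T a x) (T a x') < r.
  have := orbit_near x (@compact_set1 _ a) r0.
  by apply: filterS => x' /(_ a); exact.
exists ([set w' | mdist (T a w) (T a w') < r],
  ([set y' | mdist (T a y) (T a y') < r] `*` [set n | window n a])).
  split; first exact: near_a.
  exists ([set y' | mdist (T a y) (T a y') < r], [set n | window n a]) => //.
  split; first exact: near_a.
  exists (\sum_i Num.truncn `|a ord0 i|).+1 => // n /= an i.
  rewrite (le_trans (ltW (truncnS_gt _)))// ler_nat (leq_trans _ an)//.
  by rewrite ltnS (bigD1 i)//= leq_addr.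
move=> [w' [y' n]] /= [ww' [yy' na]] /(_ a na) y'w'; exfalso.
suff : mdist (T a y) (T a w) < mdist (T a y) (T a w) by rewrite ltxx.
rewrite [ltRHS](_ : _ = r + (delta + r)); last by rewrite /r; lra.
rewrite (le_lt_trans (metric_triangle _ (T a y') _))// ltrD//.
rewrite (le_lt_trans (metric_triangle _ (T a w') _))// ler_ltD//.
by rewrite metric_sym.
Qed.

End Compactness.

(** * Recurrent intersections of sets of positive density *)

Section RecurrentSets.
Set Implicit Arguments.
Unset Strict Implicit.
Context {R : realType} (Om : nat -> finType) (A : nat -> forall n, {set Om n}).
Hypothesis Om_gt0 : forall n, (0 < #|Om n|)%N.

Section Rich.
Variables (F : set_system nat) (FU : UltraFilter F).

Definition dense_along (B : forall n, {set Om n}) (c : R) :=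
  F [set n | c * #|Om n|%:R <= #|B n|%:R].

Lemma not_dense_along B c : ~ dense_along B c ->
  F [set n | #|B n|%:R < c * #|Om n|%:R].
Proof.
move=> nB; have [//|] := in_ultra_setVsetC [set n | c * #|Om n|%:R <= #|B n|%:R] FU.
by apply: filterS => n /= /negP; rewrite -ltNge.
Qed.

Definition rich (B : forall n, {set Om n}) := exists c : R, 0 < c /\
  forall j0, exists j, (j0 <= j)%N /\ dense_along (fun n => B n :&: A j n) c.

(** Otherwise the sets [B n :&: A i n] have asymptotically negligible pairwise intersections, while
    each selected one has density at least [c]; a union of enough of them would then have density
    above 1. *)
Lemma rich_step B j0 : rich B ->
  exists j, (j0 <= j)%N /\ rich (fun n => B n :&: A j n).
Proof.
move=> [c [c0 Bc]]; apply: contrapT => /forallNP nrich.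
have c20 : 0 < c / 2 by rewrite divr_gt0.
(* Past the threshold [g i s], intersections with [B n :&: A i n] are so sparse that [s] of them
   together have density at most [c / 2]. *)
have /choice[g gP] i : exists j1, (j0 <= i)%N -> forall (s : nat) j, (j1 s <= j)%N ->
    ~ dense_along (fun n => (B n :&: A i n) :&: A j n) (c / 2 / s.+1%:R).
  have [ji|_] := leqP j0 i; last by exists (fun=> 0%N).
  have /choice[h hP] : forall s : nat, exists j1, forall j, (j1 <= j)%N ->
      ~ dense_along (fun n => (B n :&: A i n) :&: A j n) (c / 2 / s.+1%:R).
    move=> s; apply: contrapT => /forallNP H; apply: (nrich i); split => //.
    exists (c / 2 / s.+1%:R); split; first by rewrite divr_gt0.
    move=> j1; have /existsNP[j /not_implyP[j1j /contrapT dj]] := H j1.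
    by exists j.
  by exists h.
have grow k : exists S : seq nat, (forall i, i \in S -> (j0 <= i)%N) /\
    dense_along (fun n => \bigcup_(i <- S) (B n :&: A i n))%SET (k%:R * (c / 2)).
  elim: k => [|k [S [Sj0 SU]]].
    exists [::]; split=> //; rewrite /dense_along.
    rewrite (_ : [set n | _] = setT); first exact: filterT.
    by apply/seteqP; split=> n //= _; rewrite !mul0r.
  set U := (fun n => _) in SU.
  suff [j [j0j dj]] : exists j, (j0 <= j)%N /\
      dense_along (fun n => (B n :&: A j n) :\: U n) (c / 2).
    exists (j :: S); split; first by move=> i; rewrite inE => /predU1P[->|/Sj0].
    apply: (filterS _ (filterI SU dj)) => n /= [Un jn].
    rewrite big_cons -/(U n) -(cardsID (U n)) finset.setDUl finset.setDv finset.setU0.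
    rewrite (finset.setIidPr (finset.subsetUr _ _)) natrD.
    by rewrite -natr1 mulrDl mul1r mulrDl lerD.
  apply: contrapT => /forallNP nd.
  pose s := size S; pose c' := c / 2 / s.+1%:R.
  (* This [j] lies past the thresholds of all members of [S], so less than half of the density [c]
     can fall inside the old union [U] and the rest is new. *)
  have [j [jS dj]] := Bc (maxn j0 (\max_(i <- S) g i s)).
  have j0j : (j0 <= j)%N by apply: leq_trans jS; exact: leq_maxl.
  have /not_dense_along djU : ~ dense_along (fun n => (B n :&: A j n) :\: U n) (c / 2).
    by move=> djU; exact: (nd j).
  have Si : F [set n | forall i, i \in S ->
      #|(B n :&: A i n) :&: A j n|%:R < c' * #|Om n|%:R].
    have : forall i, i \in S -> F [set n |
        #|(B n :&: A i n) :&: A j n|%:R < c' * #|Om n|%:R].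
      move=> i iS; apply: not_dense_along; apply: gP; first exact: Sj0.
      rewrite (leq_trans _ jS)// (leq_trans _ (leq_maxr _ _))//.
      by rewrite (big_rem i)//= leq_maxl.
    elim: (S) => [_|i S' IHS SF]; first by apply: filterS filterT => n.
    have iF := SF i (mem_head _ _).
    have S'F := IHS (fun i' i'S => SF i' (mem_behead (s := i :: S') i'S)).
    by apply: filterS (filterI iF S'F) => n [/= ni nS] i'; rewrite inE => /predU1P[->|/nS].
  have [n [/= [njU nj] nS]] := @filter_ex _ F _ _ (filterI (filterI djU dj) Si).
  have : #|(B n :&: A j n) :&: U n|%:R <= c / 2 * #|Om n|%:R.
    have UE : ((B n :&: A j n) :&: U n \subset
        \bigcup_(i <- S) ((B n :&: A i n) :&: A j n))%SET.
      apply/fintype.subsetP => t; rewrite !inE => /andP[/andP[_ tj]].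
      rewrite /U; elim: (S) => [|i S' IHS]; first by rewrite big_nil inE.
      by rewrite !big_cons !inE => /orP[->|/IHS ->]; rewrite ?tj ?orbT.
    have le_sum : (#|(\bigcup_(i <- S) ((B n :&: A i n) :&: A j n))%SET|%:R : R) <=
        s%:R * (c' * #|Om n|%:R).
      rewrite /s; elim: (S) nS => [|i S' IHS] nS.
        by rewrite big_nil finset.cards0 mul0r.
      rewrite big_cons /= -natr1 mulrDl mul1r addrC.
      rewrite (le_trans (_ : _ <= #|(B n :&: A i n) :&: A j n|%:R +
        #|(\bigcup_(i <- S') ((B n :&: A i n) :&: A j n))%SET|%:R))//.
        by rewrite -natrD ler_nat cardsU leq_subr.
      rewrite lerD//; first by rewrite ltW// nS ?mem_head.
      by apply: IHS => i' i'S; apply: nS; rewrite inE i'S orbT.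
    apply: (@le_trans _ _ (#|(\bigcup_(i <- S) ((B n :&: A i n) :&: A j n))%SET|%:R)).
      by rewrite ler_nat subset_leq_card.
    apply: le_trans le_sum _.
    rewrite mulrA ler_wpM2r// /c' mulrCA ger_pMr// ler_pdivrMr// mul1r ler_nat.
    exact: leqnSn.
  have := cardsID (U n) (B n :&: A j n) => /(congr1 (fun m => m%:R : R)).
  rewrite natrD => E; move: nj njU; rewrite -E => nj njU; lra.
have [k ck] : exists k, 1 < k%:R * (c / 2).
  exists (Num.truncn (2 / c)).+1; rewrite -ltr_pdivrMr// invf_div mul1r.
  exact: truncnS_gt.
have [S [_ SU]] := grow k.
have [n /= nS] := @filter_ex _ F _ _ SU.
have : (#|(\bigcup_(i <- S) (B n :&: A i n))%SET|%:R : R) <= #|Om n|%:R.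
  by rewrite ler_nat max_card.
apply/negP; rewrite -ltNge (lt_le_trans _ nS)// ltr_pMl// ltr0n.
exact: Om_gt0.
Qed.

End Rich.

(* A form of Ptak's lemma. Along an ultrafilter, the successive intersections of
   the selected sets keep positive density. *)
Lemma recurrent_indices (c : R) : 0 < c ->
  (forall j, \forall n \near \oo, c * #|Om n|%:R <= #|A j n|%:R) ->
  exists f : nat -> nat, (forall i, (i <= f i)%N) /\
    forall k, exists n, (k <= n)%N /\
      exists t, forall i, (i <= k)%N -> t \in A (f i) n.
Proof.
move=> c0 Ac; have [F [FU ooF]] := @ultraFilterLemma _ \oo _.
(* Bundling richness with the sets lets [choice] turn [rich_step] into a function that can be
   iterated. *)
pose RB := {B | rich F B}.
have /choice[G GP] : forall p : nat * RB, exists q : nat * RB, (p.1 <= q.1)%N /\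
    sval q.2 = (fun n => sval p.2 n :&: A q.1 n).
  move=> [k [B rB]]; have [j [kj rj]] := rich_step FU k rB.
  by exists (j, exist _ _ rj).
have rT : rich F (fun n => [set: Om n]%SET).
  exists c; split=> // j0; exists j0; split=> //; apply: ooF.
  by apply: filterS (Ac j0) => n; rewrite /= finset.setTI.
pose s := fix s k : RB := if k is k'.+1 then (G (k', s k')).2 else exist _ _ rT.
pose f k := (G (k, s k)).1.
exists f; split; first by move=> i; exact: (GP (i, s i)).1.
(* The set [s k.+1] is the intersection over the indices [f 0], ..., [f k]; positive density along
   [F] makes it nonempty for some [n] above [k]. *)
move=> k; have [c1 [c10 /(_ 0%N)[j [_ dj]]]] := svalP (s k.+1).
have kF : F [set n | (k <= n)%N] by apply: ooF; exact: nbhs_infty_ge.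
have [n [/= kn nj]] := @filter_ex _ F _ _ (filterI kF dj).
have : (0 < #|sval (s k.+1) n :&: A j n|)%N.
  rewrite -(ltr0n R); apply: lt_le_trans nj.
  by rewrite mulr_gt0// ltr0n.
move=> /card_gt0P[t]; rewrite inE => /andP[tk _].
exists n; split=> //; exists t; move: tk; elim: (k) => [|m IHm] /=.
  rewrite (GP (0%N, s 0%N)).2 inE => /andP[_ t0] i.
  by rewrite leqn0 => /eqP ->.
rewrite (GP (m.+1, s m.+1)).2 inE => /andP[/IHm tm tm1] i.
by rewrite leq_eqVlt => /predU1P[->|/tm].
Qed.

End RecurrentSets.

(** * Minimal spanning cardinalities, translations and tilings *)

Section SpanningNumber.
Set Implicit Arguments.
Unset Strict Implicit.
Context {R : realType} {D : nat} {X : metricType R} (T : 'rV[R]_D -> X -> X).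
Hypotheses (compactX : compact [set: X]) (actT : continuous_action T).
Implicit Types (K : set X) (Q : set 'rV[R]_D) (eps L : R) (k m n b : nat).

(** For compact [Q] and positive [eps] the default branch is never reached, by [spans_exists]. *)
Definition span_card K Q eps : nat :=
  if pselect (exists k, `[< spans T K Q eps k >]) is left ex_k then ex_minn ex_k
  else 0%N.

Lemma span_cardP K Q eps : compact Q -> 0 < eps ->
  spans T K Q eps (span_card K Q eps).
Proof.
move=> cQ eps0; rewrite /span_card; case: pselect => [ex_k|[]].
  by case: ex_minnP => k /asboolP.
have [k kP] := spans_exists compactX actT cQ eps0.
by exists k; apply/asboolP; apply: sub_spans kP.
Qed.

Lemma span_card_le K Q eps k : spans T K Q eps k -> (span_card K Q eps <= k)%N.
Proof.
move=> kP; rewrite /span_card; case: pselect => [ex_k|//].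
by case: ex_minnP => l _; apply; apply/asboolP.
Qed.

Lemma span_card_gt0 K Q eps : compact Q -> 0 < eps -> K !=set0 ->
  (0 < span_card K Q eps)%N.
Proof.
move=> cQ eps0 [x Kx]; have [E [Ek EK]] := @span_cardP K Q eps cQ eps0.
by rewrite (leq_trans _ Ek)//; have [y + _] := EK x Kx; case: (E).
Qed.

Definition ln_span K Q eps : R := ln (span_card K Q eps)%:R.

Lemma ln_span_ge0 K Q eps : 0 <= ln_span K Q eps.
Proof.
rewrite /ln_span; case: (span_card _ _ _) => [|k]; first by rewrite ln0.
by rewrite ln_ge0// ler1n.
Qed.

Lemma ln_span_le K Q eps k : spans T K Q eps k -> ln_span K Q eps <= ln k%:R.
Proof.
move=> /span_card_le; rewrite /ln_span; case: (span_card _ _ _) => [|l] lk.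
  by rewrite ln0//; case: k lk => [|k] _; [rewrite ln0|rewrite ln_ge0// ler1n].
by rewrite ler_ln ?posrE ?ltr0n// ?ler_nat//; exact: leq_trans lk.
Qed.

Lemma ln_span_bigcup (J : eqType) (I : seq J) (Qs : J -> set 'rV[R]_D) K Q eps :
  K !=set0 -> 0 < eps ->
  (forall a, Q a -> exists2 i, i \in I & Qs i a) ->
  (forall i, i \in I -> compact (Qs i)) ->
  ln_span K Q (2 * eps) <= \sum_(i <- I) ln_span K (Qs i) eps.
Proof.
move=> K0 eps0 QI cI.
have IK i : i \in I -> spans T K (Qs i) eps (span_card K (Qs i) eps).
  by move=> /cI ci; exact: span_cardP.
apply: le_trans (ln_span_le (spans_prod QI IK)) _.
rewrite natr_prod.
(* Positivity of the product is carried through the induction because [lnM] asks for it; it comes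
   from [K] being nonempty. *)
suff [-> _] : ln (\prod_(i <- I) (span_card K (Qs i) eps)%:R) =
    \sum_(i <- I) ln_span K (Qs i) eps :> R /\
    0 < \prod_(i <- I) (span_card K (Qs i) eps)%:R :> R by [].
elim: I cI {QI IK} => [|i I IHI] cI; first by rewrite !big_nil ln1.
have [|IH I0] := IHI; first by move=> j jI; apply: cI; rewrite inE jI orbT.
have i0 : 0 < (span_card K (Qs i) eps)%:R :> R.
  by rewrite ltr0n span_card_gt0//; apply: cI; rewrite inE eqxx.
by rewrite !big_cons -IH lnM ?posrE// mulr_gt0.
Qed.

(** Since [T a x] is [T (a - t) (T t x)], a spanning set for the translated data is moved back by
    [T (- t)]. *)
Lemma spans_shift (t : 'rV[R]_D) K K' Q Q' eps k :
  (forall x, K x -> K' (T t x)) -> (forall a, Q a -> Q' (a - t)) ->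
  spans T K' Q' eps k -> spans T K Q eps k.
Proof.
move=> KK' QQ' [E [Ek EK']]; exists [seq T (- t) e | e <- E].
split; first by rewrite size_map.
move=> x /KK' /EK'[e eE xe]; exists (T (- t) e); first exact: map_f.
move=> a /QQ' /xe; rewrite -(actD actT) subrK.
by rewrite (actD actT a).
Qed.

Definition tile (t : 'rV[R]_D) (L : R) : set 'rV[R]_D :=
  [set a | forall i, t ord0 i <= a ord0 i <= t ord0 i + L].

Lemma tile_compact t L : compact (tile t L).
Proof.
rewrite (_ : tile t L = [set v : 'rV[R]_D | forall i,
    `[t ord0 i, t ord0 i + L]%classic (v ord0 i)]).
  apply: (@rV_compact R D (fun i => `[t ord0 i, t ord0 i + L]%classic)) => i.
  exact: segment_compact.
by apply/seteqP; split=> v vL i; have := vL i; rewrite /= in_itv.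
Qed.

Definition corner b n (t : {ffun 'I_D -> 'I_b}) : 'rV[R]_D :=
  \row_i ((t i)%:R - n%:R).

(* For each residue class of [t] modulo [m], the tiles at its corners cover the
   cube; the statement adds up the [m ^ D] resulting inequalities. *)
Lemma ln_span_cube_le K L eps m n b : K !=set0 -> 0 < eps -> (0 < m <= n)%N ->
  (Num.truncn L + n < b)%N ->
  (m ^ D)%:R * ln_span K (cube L) (2 * eps) <=
  \sum_(t : {ffun 'I_D -> 'I_b}) ln_span K (tile (corner n t) m%:R) eps.
Proof.
case: m => // m K0 eps0 /= mn Lb.
pose res (t : {ffun 'I_D -> 'I_b}) : {ffun 'I_D -> 'I_m.+1} :=
  [ffun i => inord (t i %% m.+1)].
rewrite (partition_big res predT)//=.
have -> : (m.+1 ^ D)%:R * ln_span K (cube L) (2 * eps) =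
    \sum_(s : {ffun 'I_D -> 'I_m.+1}) ln_span K (cube L) (2 * eps).
  by rewrite sumr_const card_ffun !card_ord mulr_natl.
apply: ler_sum => s _; rewrite -big_filter.
apply: ln_span_bigcup => // [a aL|i _]; last exact: tile_compact.
have b0 : (0 < b)%N by exact: leq_ltn_trans Lb.
pose q i := Num.truncn (a ord0 i + n%:R).
have aq i : (q i)%:R <= a ord0 i + n%:R < (q i).+1%:R.
  by apply: truncn_itv; have /andP[a0 _] := aL i; rewrite addr_ge0.
have nq i : (n <= q i)%N.
  by have /andP[a0 _] := aL i; rewrite truncn_ge_nat ?lerDr// addr_ge0.
have qb i : (q i < b)%N.
  apply: leq_ltn_trans Lb; have /andP[a0 aL'] := aL i.
  rewrite -ltnS -(ltr_nat R) (le_lt_trans (andP (aq i)).1)//.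
  rewrite -addSn natrD ltrD2r (le_lt_trans aL')//.
  exact: truncnS_gt.
(* The largest index up to [q i] congruent to [s i] modulo [m.+1]; the truncated subtraction is
   exact because [s i <= m < n <= q i]. *)
pose t i := (q i - (q i - s i) %% m.+1)%N.
have sq i : (s i <= q i)%N.
  by rewrite (leq_trans _ (nq i))// (leq_trans _ mn)// ltnW.
have tb i : (t i < b)%N by exact: leq_ltn_trans (leq_subr _ _) (qb i).
exists [ffun i => Ordinal (tb i)].
  rewrite mem_filter mem_index_enum andbT; apply/eqP/ffunP => i; rewrite !ffunE /=.
  apply: val_inj => /=; rewrite inordK ?ltn_pmod// /t.
  have -> : (q i - (q i - s i) %% m.+1 = s i + (q i - s i) %/ m.+1 * m.+1)%N.
    rewrite -{1}(subnKC (sq i)) {1}(divn_eq (q i - s i) m.+1).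
    by rewrite addnA addnK.
  by rewrite addnC modnMDl modn_small.
move=> i; rewrite mxE ffunE /=.
have tq : (t i <= q i < t i + m.+1)%N.
  rewrite leq_subr /= /t.
  have := ltn_pmod (q i - s i) (isT : 0 < m.+1)%N.
  have := leq_mod (q i - s i) m.+1; lia.
have /andP[tq1 tq2] := tq; have /andP[aq1 aq2] := aq i.
have tq1' : (t i)%:R <= (q i)%:R :> R by rewrite ler_nat.
have tq2' : (q i).+1%:R <= (t i)%:R + m.+1%:R :> R by rewrite -natrD ler_nat.
by apply/andP; split; lra.
Qed.

End SpanningNumber.

(** * Uniform growth bound for finite-time balls *)

Section UniformBound.
Set Implicit Arguments.
Unset Strict Implicit.
Context {R : realType} {D : nat} {X : metricType R} (T : 'rV[R]_D -> X -> X).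
Hypotheses (compactX : compact [set: X]) (actT : continuous_action T).
Implicit Types (K : set X) (Q : set 'rV[R]_D) (eps L : R) (k m n b : nat).

Lemma ln_span_shift t K K' Q Q' eps : compact Q' -> 0 < eps ->
  (forall x, K x -> K' (T t x)) -> (forall a, Q a -> Q' (a - t)) ->
  ln_span T K Q eps <= ln_span T K' Q' eps.
Proof.
move=> cQ' eps0 KK' QQ'; apply: ln_span_le; apply: (spans_shift actT KK' QQ').
exact: (span_cardP compactX actT).
Qed.

Lemma tileB t L (a : 'rV[R]_D) : tile t L a -> cube L (a - t).
Proof. by move=> ta i; have /andP[] := ta i; rewrite !mxE; lra. Qed.

(** The cube is covered by at most [(3 * L) ^+ D] unit tiles, and translation bounds the cost of
    each by [C0]; adding 1 makes the constant positive. *)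
Lemma ln_span_cube_growth eps : 0 < eps -> exists C : R, 0 < C /\
  forall K L, K !=set0 -> 1 <= L -> ln_span T K (cube L) eps <= C * L ^+ D.
Proof.
move=> eps0; pose C0 := ln_span T setT (@cube R D 1) (eps / 2).
have C0_ge0 : 0 <= C0 by exact: ln_span_ge0.
exists (3 ^+ D * (C0 + 1)); split; first by rewrite mulr_gt0 ?exprn_gt0// ltr_wpDl.
move=> K L K0 L1.
have eps20 : 0 < eps / 2 by rewrite divr_gt0.
have := ln_span_cube_le compactX actT K0 eps20 (_ : 0 < 1 <= 1)%N
  (_ : Num.truncn L + 1 < Num.truncn L + 2)%N.
rewrite exp1n mul1r mulrC divfK// => /(_ isT); rewrite ltn_add2l => /(_ isT).
move=> /le_trans; apply.
apply: (@le_trans _ _ (\sum_(t : {ffun 'I_D -> 'I_(Num.truncn L + 2)}) C0)).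
  apply: ler_sum => t _; apply: (@ln_span_shift (corner 1 t)) => //.
    exact: cube_compact.
  by move=> a; exact: tileB.
rewrite sumr_const card_ffun !card_ord -[leLHS]mulr_natl natrX.
rewrite mulrAC ler_pM ?exprn_ge0//; last by rewrite lerDl.
rewrite -exprMn lerXn2r ?nnegrE//; first by rewrite mulr_ge0// (le_trans _ L1).
rewrite natrD; have /andP[+ _] := truncn_itv (le_trans ler01 L1); lra.
Qed.


Variables (delta eps h beta : R).
Hypotheses (eps0 : 0 < eps) (beta0 : 0 < beta).
Hypothesis pointwise : forall y, \forall m \near \oo,
  ln_span T (orbit_ball T y setT delta) (cube m%:R) eps <= h * m%:R ^+ D.

(** * Density of the bad translates in a counterexample *)

Section Counterexample.
Variables (Ls : nat -> R) (xs : nat -> X).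
Hypothesis Ls_ge : forall n, (n.+1 ^ 2)%:R <= Ls n.
Hypothesis xs_large : forall n, (h + beta) * Ls n ^+ D <
  ln_span T (orbit_ball T (xs n) (cube (Ls n)) delta) (cube (Ls n)) (2 * (2 * eps)).
Hypothesis delta0 : 0 < delta.

(* The lattice box of side [b n] is shifted by [- n], so that the tiles of side
   at most [n] at its corners cover the cube of side [Ls n]. The corners in
   [inner] are those whose translate of the window [- n, n]^D stays in the cube. *)
Let B n := orbit_ball T (xs n) (cube (Ls n)) delta.
Let u n := Num.truncn (Ls n).
Let b n := ((u n).+1 + n)%N.
Let Om n : finType := {ffun 'I_D -> 'I_(b n)}.
Let inner n : {set 'I_(b n)} := [set k : 'I_(b n) | (2 * n <= k <= u n)%N]%SET.
Let bad j n : {set Om n} := [set t : Om n | (t \in ffun_on (mem (inner n))) &&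
  ((h + beta / 2) * j.+1%:R ^+ D < ln_span T (B n) (tile (corner n t) j.+1%:R) (2 * eps))]%SET.

Let Ls_gt0 n : 0 < Ls n.
Proof. by apply: lt_le_trans (Ls_ge n); rewrite ltr0n. Qed.

Let B_neq0 n : B n !=set0.
Proof. by exists (xs n) => a _; rewrite mdistxx ltW. Qed.

Let h_ge0 : 0 <= h.
Proof.
have [m []] := @filter_ex _ \oo _ _ (filterI (pointwise (xs 0%N)) (nbhs_infty_ge 1)).
move=> hm /= m1; rewrite -(pmulr_lge0 h (_ : 0 < m%:R ^+ D)) ?exprn_gt0 ?ltr0n//.
by apply: le_trans hm; exact: ln_span_ge0.
Qed.

(** Relative width of the boundary layer: the range of inner corners and [Ls n] both fall short of
    [b n] by at most [3 * n.+1], which is negligible because [b n] exceeds [n.+1 ^ 2]. *)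
Let kappa n : R := 3 * n.+1%:R / (b n)%:R.

Let b_gt n : (n.+1 ^ 2)%:R < (b n)%:R :> R.
Proof.
apply: le_lt_trans (Ls_ge n) _; rewrite /b natrD ltr_wpDr//.
exact: truncnS_gt.
Qed.

Let kappa_small (e : R) : 0 < e -> \forall n \near \oo, kappa n <= e.
Proof.
move=> e0; exists (Num.truncn (3 / e)) => // n /= en.
have b0 : 0 < (b n)%:R :> R by apply: lt_trans (b_gt n); rewrite ltr0n.
rewrite /kappa ler_pdivrMr//; apply: (@le_trans _ _ (e * (n.+1 ^ 2)%:R)); last first.
  by rewrite ler_pM2l// ltW.
rewrite natrX expr2 mulrA ler_pM2r ?ltr0n// mulrC -ler_pdivrMr//.
by apply/ltW/(lt_le_trans (truncnS_gt _)); rewrite ler_nat ltnS.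
Qed.

Let card_Om n : #|Om n|%:R = (b n)%:R ^+ D :> R.
Proof. by rewrite card_ffun !card_ord natrX. Qed.

(** Bernoulli's inequality turns the relative loss [kappa n] per side into a volume loss of at most
    [D%:R * kappa n]. *)
Let shrink n (v : R) : kappa n <= 1 -> (b n)%:R - 3 * n.+1%:R <= v ->
  (1 - D%:R * kappa n) * #|Om n|%:R <= v ^+ D.
Proof.
move=> k1 bv; have k0 : 0 <= kappa n by rewrite /kappa divr_ge0// mulr_ge0.
have b_neq0 : (b n)%:R != 0 :> R by rewrite pnatr_eq0.
have bk : (1 - kappa n) * (b n)%:R = (b n)%:R - 3 * n.+1%:R.
  by rewrite mulrBl mul1r /kappa divfK.
have bk0 : 0 <= (1 - kappa n) * (b n)%:R by rewrite mulr_ge0// subr_ge0.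
rewrite card_Om; apply: (@le_trans _ _ ((1 - kappa n) ^+ D * (b n)%:R ^+ D)).
  by rewrite ler_wpM2r ?exprn_ge0// bernoulli// k0.
have v0 : 0 <= v by apply: le_trans bv; rewrite -bk.
by rewrite -exprMn lerXn2r ?nnegrE// bk.
Qed.

Let inner_large n : kappa n <= 1 ->
  (1 - D%:R * kappa n) * #|Om n|%:R <= #|(ffun_on (mem (inner n)) : {pred Om n})|%:R.
Proof.
move=> k1; rewrite card_ffun_on card_ord natrX; apply: shrink => //.
have ub : (u n < b n)%N by rewrite /b; lia.
have := card_ord_itv (2 * n) ub; rewrite -/(inner n) -(ler_nat R) => /(le_trans _); apply.
have : ((b n)%:R <= ((u n).+1 - 2 * n)%:R + 3 * n.+1%:R :> R).
  by rewrite -natrM -natrD ler_nat /b; lia.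
lra.
Qed.

Let volume_large n : kappa n <= 1 ->
  (1 - D%:R * kappa n) * #|Om n|%:R <= Ls n ^+ D.
Proof.
move=> k1; apply: shrink => //.
have /andP[+ _] := truncn_itv (ltW (Ls_gt0 n)); rewrite -/(u n).
have : ((b n)%:R <= (u n)%:R + 3 * n.+1%:R :> R).
  by rewrite -natrM -natrD ler_nat /b; lia.
lra.
Qed.

(** Averaging: the tile costs sum to more than [h + beta] per unit volume up to boundary terms, an
    inner corner that is not bad pays at most [h + beta / 2], and any corner at most [C]. Of the
    surplus [beta / 2], half absorbs the boundary and the other half gives the density
    [beta / (4 * C)], the same for all [j]. *)
Let bad_dense : exists c : R, 0 < c /\
  forall j, \forall n \near \oo, c * #|Om n|%:R <= #|bad j n|%:R.
Proof.
have eps20 : 0 < 2 * eps by rewrite mulr_gt0.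
have [C [C0 CP]] := ln_span_cube_growth eps20.
exists (beta / (4 * C)); split; first by rewrite divr_gt0// mulr_gt0.
(* Times [kappa n], this is the total boundary loss; the [W + 1] below avoids a zero denominator
   when [D] is 0. *)
move=> j; pose W := D%:R * (h + beta + C).
have W0 : 0 <= W by rewrite mulr_ge0// !addr_ge0// ltW.
have e0 : 0 < beta / 4 / (W + 1) by rewrite !divr_gt0// ltr_wpDl.
near=> n.
have jn : (0 < j.+1 <= n)%N by rewrite /=; near: n; exact: nbhs_infty_gt.
have k1 : kappa n <= 1 by near: n; exact: kappa_small.
have ke : kappa n <= beta / 4 / (W + 1) by near: n; exact: kappa_small.
have k0 : 0 <= kappa n by rewrite /kappa divr_ge0// mulr_ge0.
have kW : D%:R * kappa n * (h + beta + C) <= beta / 4.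
  rewrite mulrAC -/W mulrC (le_trans (ler_wpM2r W0 ke))// mulrAC ler_pdivrMr ?ltr_wpDl//.
  by rewrite ler_pM2l ?divr_gt0// lerDl.
set V : R := #|Om n|%:R; set M : R := j.+1%:R ^+ D.
have V0 : 0 < V by rewrite /V card_Om exprn_gt0// ltr0n.
have M0 : 0 < M by rewrite exprn_gt0// ltr0n.
pose phi (t : Om n) := ln_span T (B n) (tile (corner n t) j.+1%:R) (2 * eps).
have phi_le t : phi t <= C * M.
  apply: le_trans (CP (T (corner n t) @` B n) j.+1%:R _ _); last 2 first.
  - by have [x Bx] := B_neq0 n; exists (T (corner n t) x), x.
  - by rewrite ler1n.
  apply: (@ln_span_shift (corner n t)) => //; first exact: cube_compact.
  by move=> a; exact: tileB.
have sum_ge : M * ((h + beta) * Ls n ^+ D) < \sum_t phi t.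
  have ub : (u n + n < b n)%N by rewrite /b addSn.
  apply: lt_le_trans (ln_span_cube_le compactX actT (B_neq0 n) eps20 jn ub).
  by rewrite natrX -/M ltr_pM2l//; exact: xs_large.
pose I : {pred Om n} := ffun_on (mem (inner n)).
(* The bound holds term by term: [C * M] is paid on bad corners and on corners outside [I]. *)
have sum_le : \sum_t phi t <= (h + beta / 2) * M * V + C * M * #|bad j n|%:R +
    C * M * (V - #|I|%:R).
  have cardE (P : {pred Om n}) : \sum_t (t \in P)%:R = #|P|%:R :> R.
    by rewrite -natr_sum -sum1_card [in RHS]big_mkcond; congr (_%:R);
      apply: eq_bigr => t _; case: ifP.
  have -> : V - #|I|%:R = #|[predC I]|%:R by rewrite /V -(cardC I) natrD addrC addKr.
  have -> : (h + beta / 2) * M * V = \sum_(t : Om n) (h + beta / 2) * M.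
    by rewrite sumr_const -[RHS]mulr_natr.
  rewrite -(cardE (mem (bad j n))) -(cardE [predC I]) !mulr_sumr -!big_split /=.
  apply: ler_sum => t _; rewrite !inE -/(phi t) -/M.
  have hM : 0 <= (h + beta / 2) * M by rewrite mulr_ge0 ?addr_ge0 ?divr_ge0// ltW.
  have CM : 0 <= C * M by apply: mulr_ge0; exact: ltW.
  have := phi_le t; case: [forall x, _] => /=; last by lra.
  by case: ltP => /=; lra.
have {sum_le} : (h + beta) * Ls n ^+ D < (h + beta / 2) * V + C * #|bad j n|%:R +
    C * (V - #|I|%:R).
  rewrite -(ltr_pM2l M0); apply: lt_le_trans sum_ge (le_trans sum_le _).
  by rewrite le_eqVlt; apply/orP; left; apply/eqP; ring.
have Vl : (h + beta) * ((1 - D%:R * kappa n) * V) <= (h + beta) * Ls n ^+ D.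
  by rewrite ler_wpM2l ?volume_large// addr_ge0// ltW.
have Vi : C * ((1 - D%:R * kappa n) * V) <= C * #|I|%:R.
  by rewrite ler_pM2l// inner_large.
have Vk := ler_wpM2r (ltW V0) kW.
have -> : beta / (4 * C) * V = C^-1 * (beta / 4 * V) by field; rewrite gt_eqF.
rewrite ler_pdivrMl// => main; lra.
Unshelve. all: by end_near. Qed.

(* Corners that are bad for arbitrarily many scales, transported to the origin,
   accumulate at a point that is bad for infinitely many scales. *)
Lemma no_counterexample : False.
Proof.
have [c [c0 bc]] := bad_dense.
have Om0 n : (0 < #|Om n|)%N by rewrite -(ltr0n R) card_Om exprn_gt0 ?ltr0n.
have [f [fge fP]] := recurrent_indices Om0 c0 bc.
have /choice[nt ntP] : forall k, exists p : {n & Om n}, (k <= tag p)%N /\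
    forall i, (i <= k)%N -> tagged p \in bad (f i) (tag p).
  by move=> k; have [n [kn [t tP]]] := fP k; exists (Tagged Om t).
pose z k := T (corner (tag (nt k)) (tagged (nt k))) (xs (tag (nt k))).
have [y [_ yz]] := @compactX (z @ \oo) _ filterT.
have [M _ HM] := pointwise y.
(* Since [M <= f M], this side is large enough for the pointwise bound at [y], and it is a bad scale
   for every [z k] with [k] at least [M]. *)
set m := (f M).+1.
have := HM m; rewrite /= leqW ?fge// => /(_ isT).
set k0 := span_card T (orbit_ball T y setT delta) (cube m%:R) eps => hk0.
have yk0 : spans T (orbit_ball T y setT delta) (cube m%:R) eps k0.
  by apply: (span_cardP compactX actT) => //; exact: cube_compact.
have [[/= U V] [yU [N _ NV]] UV] :=
  spans_orbit_ball_near compactX actT (@cube_compact R D m%:R) eps0 yk0.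
pose K := maxn M N.
have [|w [[k Kk <-] Uzk]] := yz (z @` [set k | (K <= k)%N]) U _ yU.
  by exists K => // k Kk; exists k.
have /= zk0 := UV (z k, k) (conj Uzk (NV k (leq_trans (leq_maxr _ _) Kk))).
have [kn /(_ M (leq_trans (leq_maxl _ _) Kk))] := ntP k.
set n := tag (nt k); set t := tagged (nt k).
rewrite inE => /andP[/ffun_onP tin]; apply/negP; rewrite -leNgt.
(* As [k <= n], an inner corner keeps its translate of [window k] in the cube, so the translated
   [B n] lies in the window ball of [z k] and inherits its spanning bound. *)
have : ln_span T (B n) (tile (corner n t) m%:R) (2 * eps) <= ln k0%:R.
  apply: ln_span_le; apply: (spans_shift actT _ _ zk0) => [x Bx a ak|a]; last exact: tileB.
  rewrite -!(actD actT); apply: Bx => i; rewrite !mxE.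
  have := tin i; rewrite inE => /andP[ti1 ti2].
  have := ak i; rewrite ler_norml => /andP[ak1 ak2].
  have kn' : k%:R <= n%:R :> R by rewrite ler_nat.
  have ti1' : 2 * n%:R <= (t i)%:R :> R by rewrite -natrM ler_nat.
  have ti2' : (t i)%:R <= (u n)%:R :> R by rewrite ler_nat.
  have /andP[uL _] := truncn_itv (ltW (Ls_gt0 n)); rewrite -/(u n) in uL.
  by apply/andP; split; lra.
move=> /le_trans; apply; apply: (le_trans hk0).
by rewrite ler_wpM2r ?exprn_ge0// lerDl divr_ge0// ltW.
Qed.

End Counterexample.
End UniformBound.

(** * Upper and lower limits in the extended reals *)

Section LimitBounds.
Set Implicit Arguments.
Unset Strict Implicit.
Context {R : realType}.
Local Open Scope ereal_scope.

Lemma limf_esup_lt (U : choiceType) (I : filteredType U)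
    (F : set_system I) (f : I -> \bar R) r :
  Filter F -> limf_esup f F < r -> \forall x \near F, f x < r.
Proof.
move=> FF /ereal_inf_lt[_ [V FV <-] Vr]; apply: filterS FV => x Vx.
by apply: le_lt_trans Vr; apply: ereal_sup_ubound; exists x.
Qed.

Lemma limf_esup_le (U : choiceType) (I : filteredType U)
    (F : set_system I) (f : I -> \bar R) r :
  (\forall x \near F, f x <= r) -> limf_esup f F <= r.
Proof.
move=> Fr; apply: le_trans (ereal_inf_lbound _) _.
  by exists [set x | f x <= r].
by apply: ge_ereal_sup => _ [x xr <-].
Qed.

Lemma limf_einf_lt (U : choiceType) (I : filteredType U)
    (F : set_system I) (f : I -> \bar R) r V :
  limf_einf f F < r -> F V -> exists2 x, V x & f x < r.
Proof.
rewrite limf_einfE => fr FV.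
have /ereal_inf_lt[_ [x Vx <-] xr] : ereal_inf (f @` V) < r.
  by apply: le_lt_trans fr; apply: ereal_sup_ubound; exists V.
by exists x.
Qed.

Lemma limf_einf_le (U : choiceType) (I : filteredType U)
    (F : set_system I) (f : I -> \bar R) r :
  (forall V, F V -> exists2 x, V x & f x <= r) -> limf_einf f F <= r.
Proof.
move=> Fr; rewrite limf_einfE; apply: ge_ereal_sup => _ [V FV <-].
have [x Vx xr] := Fr V FV; apply: le_trans xr.
by apply: ereal_inf_lbound; exists x.
Qed.

(** Reduces comparisons of limits to real bounds with a slack; when [y] is [-oo], the freedom in [r]
    rules out any other [x]. *)
Lemma lee_lt_approx (x y : \bar R) :
  (forall (r e : R), y < r%:E -> (0 < e)%R -> x <= (r + e)%:E) -> x <= y.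
Proof.
case: y => [y||] H; last 2 first.
- exact: leey.
- case: x H => [x||] H; last by [].
    by have := H (x - 2)%R 1%R (ltNyr _) ltr01; rewrite lee_fin => ?; exfalso; lra.
  by have := H 0%R 1%R (ltNyr _) ltr01.
apply/lee_addgt0Pr => e e0; rewrite -EFinD [e in leRHS]splitr addrA.
by apply: H; rewrite ?lte_fin ?ltrDl divr_gt0.
Qed.

Lemma lee_div (r : R) (x y : \bar R) : (0 < r)%R -> 
  (x / r%:E <= y) = (x <= y * r%:E).
Proof. by move=> r0; rewrite inver gt_eqF// lee_pdivrMr. Qed.

Lemma lte_div (r : R) (x y : \bar R) : (0 < r)%R -> 
  (x / r%:E < y) = (x < y * r%:E).
Proof. by move=> r0; rewrite inver gt_eqF// lte_pdivrMr. Qed.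

Lemma near_right0P (P : R -> Prop) : (\forall e \near 0^'+, P e) <->
  exists2 d, (0 < d)%R & forall e : R, (0 < e < d)%R -> P e.
Proof.
split=> [[d d0 dP]|[d d0 dP]].
  exists d => // e /andP[e0 ed]; apply: dP => //=.
  by rewrite sub0r normrN gtr0_norm.
near=> e; apply: dP; apply/andP; split; near: e; first exact: nbhs_right_gt.
exact: nbhs_right_lt.
Unshelve. all: by end_near. Qed.

Lemma near_right0_scale (c : R) (P : R -> Prop) : (0 < c)%R ->
  (\forall e \near 0^'+, P e) -> \forall e \near 0^'+, P (c * e)%R.
Proof.
move=> c0 /near_right0P[d d0 dP]; apply/near_right0P.
exists (d / c)%R; first by rewrite divr_gt0.
by move=> e /andP[e0 ed]; apply: dP; rewrite mulr_gt0//= mulrC -ltr_pdivlMr.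
Qed.

Lemma near_right0_unscale (c : R) (P : R -> Prop) : (0 < c)%R ->
  (\forall e \near 0^'+, P (c * e)%R) -> \forall e \near 0^'+, P e.
Proof.
move=> c0 /(near_right0_scale (P := fun e => P (c * e)%R)) H.
have := H c^-1%R; rewrite invr_gt0 => /(_ c0); apply: filterS => e.
by rewrite mulVKf ?gt_eqF.
Qed.

Lemma near_ln_inv_ge (M : R) : \forall e \near 0^'+, (M <= ln (1 / e))%R.
Proof.
apply/near_right0P; exists (expR (- M)); first exact: expR_gt0.
move=> e /andP[e0 eM]; rewrite div1r lnV ?posrE// lerNr -(expRK (- M)%R).
by rewrite ler_ln ?posrE ?expR_gt0// ltW.
Qed.

End LimitBounds.

(** * Entropy as a growth rate and Bowen's inequality *)

Section Entropy.
Set Implicit Arguments.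
Unset Strict Implicit.
Context {R : realType} {D : nat} {X : metricType R} (T : 'rV[R]_D -> X -> X).
Hypotheses (compactX : compact [set: X]) (actT : continuous_action T).
Implicit Types (K : set X) (Q : set 'rV[R]_D) (eps L : R).

Lemma cube_neq0 L : 0 <= L -> @cube R D L !=set0.
Proof. by move=> L0; exists 0 => i; rewrite mxE lexx. Qed.

Lemma span_numE K Q eps : compact Q -> Q !=set0 -> 0 < eps ->
  span_num K (dist_on T Q) eps = (span_card T K Q eps)%:R%:E.
Proof.
move=> cQ Q0 eps0; apply/eqP; rewrite eq_le; apply/andP; split.
  have [E [Ek EK]] := span_cardP compactX actT K cQ eps0.
  apply: (@le_trans _ _ (#|` [fset x in E]%fset|%:R)%:E).
    apply: ereal_inf_lbound; exists [fset x in E]%fset => // x /EK[y yE xy].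
    by exists y; [rewrite /= !inE|apply/(dist_onP T compactX Q0)].
  rewrite lee_fin ler_nat (leq_trans _ Ek)//.
  by rewrite card_fseq size_undup.
apply: le_ereal_inf_tmp => _ [E EK <-]; rewrite lee_fin ler_nat.
apply: span_card_le; exists (enum_fset E); split=> // x /EK[y yE xy].
by exists y => //; apply/(dist_onP T compactX Q0).
Qed.

(** Nonemptiness of [K] keeps the spanning number away from 0, where [lne] is [-oo] but [ln] is
    0. *)
Lemma entropy_term K eps L : K !=set0 -> 0 < eps -> 0 < L ->
  (lne (span_num K (dist_on T (cube L)) eps) / (L ^+ D)%:E)%E =
  (ln_span T K (cube L) eps / L ^+ D)%:E.
Proof.
move=> K0 eps0 L0; rewrite span_numE//; last 2 first.
- exact: cube_compact.
- exact/cube_neq0/ltW.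
rewrite lne_EFin; last first.
  by rewrite ltr0n (span_card_gt0 compactX actT)//; exact: cube_compact.
by rewrite inver gt_eqF ?exprn_gt0.
Qed.

Lemma entropy_lt K eps (r : R) : K !=set0 -> 0 < eps -> (entropy T K eps < r%:E)%E ->
  \forall L \near +oo, ln_span T K (cube L) eps <= r * L ^+ D.
Proof.
move=> K0 eps0 /limf_esup_lt Kr; near=> L.
have L0 : 0 < L by near: L; exact: nbhs_pinfty_gt.
rewrite -ler_pdivrMr ?exprn_gt0// -lee_fin -entropy_term//; apply: ltW.
by near: L; exact: Kr.
Unshelve. all: by end_near. Qed.

Lemma entropy_le K eps (r : R) : K !=set0 -> 0 < eps ->
  (\forall L \near +oo, ln_span T K (cube L) eps <= r * L ^+ D) ->
  (entropy T K eps <= r%:E)%E.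
Proof.
move=> K0 eps0 Kr; apply: limf_esup_le; near=> L.
have L0 : 0 < L by near: L; exact: nbhs_pinfty_gt.
rewrite entropy_term// lee_fin ler_pdivrMr ?exprn_gt0//.
by near: L.
Unshelve. all: by end_near. Qed.

Lemma dyn_ballT delta x :
  dyn_ball T delta x [set: 'rV[R]_D] = orbit_ball T x setT delta.
Proof.
apply/seteqP; split=> y /=; first by move/(dist_onP T compactX (ex_intro _ 0 I)).
by move=> xy; apply/(dist_onP T compactX (ex_intro _ 0 I)).
Qed.

(** Failure for arbitrarily large [L] would provide the sides and centers excluded by
    [no_counterexample]. The scale doubles once in combining tiles and once in passing to nearby
    points. *)
Lemma ln_span_orbit_ball_le delta eps h beta : 0 < delta -> 0 < eps -> 0 < beta ->
  (forall y, \forall m \near \oo,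
    ln_span T (orbit_ball T y setT delta) (cube m%:R) eps <= h * m%:R ^+ D) ->
  \forall L \near +oo, forall x,
    ln_span T (orbit_ball T x (cube L) delta) (cube L) (2 * (2 * eps)) <=
    (h + beta) * L ^+ D.
Proof.
move=> delta0 eps0 beta0 pointwise.
have [H|//] := near_pinfty_contra (fun L => forall x,
  ln_span T (orbit_ball T x (cube L) delta) (cube L) (2 * (2 * eps)) <=
  (h + beta) * L ^+ D).
exfalso; have /choice[Lx LxP] : forall n : nat, exists p : R * X,
    (n.+1 ^ 2)%:R <= p.1 /\ (h + beta) * p.1 ^+ D <
    ln_span T (orbit_ball T p.2 (cube p.1) delta) (cube p.1) (2 * (2 * eps)).
  move=> n; have [L nL /existsNP[x /negP]] := H (n.+1 ^ 2)%:R.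
  by rewrite -ltNge => xL; exists (L, x).
exact: (no_counterexample compactX actT eps0 beta0 pointwise
  (Ls := fun n => (Lx n).1) (xs := fun n => (Lx n).2)
  (fun n => (LxP n).1) (fun n => (LxP n).2) delta0).
Qed.

(** Spanning at scale [delta] is refined inside each ball. The [2] is made of two unit slacks: one
    makes the bound on local entropies strict, the other is the [beta] of the uniform bound. *)
Lemma entropy_le_local delta eps s h : [set: X] !=set0 -> 0 < delta -> 0 < eps ->
  (entropy T setT delta < s%:E)%E ->
  (forall x, (entropy T (dyn_ball T delta x setT) eps <= h%:E)%E) ->
  (entropy T setT (2 * (2 * eps)) <= (s + h + 2)%:E)%E.
Proof.
move=> X0 delta0 eps0 Ts Bh.
have B_neq0 x Q : orbit_ball T x Q delta !=set0.
  by exists x => a _; rewrite mdistxx ltW.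
have pointwise y : \forall m \near \oo,
    ln_span T (orbit_ball T y setT delta) (cube m%:R) eps <= (h + 1) * m%:R ^+ D.
  apply: (near_pinfty_nat (P := fun L =>
    ln_span T (orbit_ball T y setT delta) (cube L) eps <= (h + 1) * L ^+ D)).
  apply: entropy_lt => //; rewrite -dyn_ballT.
  by apply: le_lt_trans (Bh y) _; rewrite lte_fin ltrDl.
have {}Ts := entropy_lt X0 delta0 Ts.
have Bs := ln_span_orbit_ball_le delta0 eps0 ltr01 pointwise.
have eps4 : 0 < 2 * (2 * eps) by rewrite !mulr_gt0.
apply: entropy_le => //; near=> L.
(* One integer bounding the spanning numbers of all the balls at once, as the covering step
   requires. *)
set l := Num.truncn (expR ((h + 1 + 1) * L ^+ D)).
have Bl x : (span_card T (orbit_ball T x (cube L) delta) (cube L) (2 * (2 * eps)) <= l)%N.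
  rewrite truncn_ge_nat ?expR_ge0// -ler_ln ?posrE ?expR_gt0//; last first.
    by rewrite ltr0n (span_card_gt0 compactX actT)//; exact: cube_compact.
  by rewrite expRK; move: x; near: L.
have cL := @cube_compact R D L.
have [x0 _] := X0.
have l0 : (0 < l)%N.
  by apply: leq_trans (Bl x0); rewrite (span_card_gt0 compactX actT).
have k0 : (0 < span_card T setT (cube L) delta)%N.
  by rewrite (span_card_gt0 compactX actT).
have /ln_span_le : spans T setT (cube L) (2 * (2 * eps))
    (span_card T setT (cube L) delta * l).
  apply: spans_orbit_balls (span_cardP compactX actT _ cL delta0) _ => x.
  exact: spans_leq (Bl x) (span_cardP compactX actT _ cL eps4).
rewrite natrM lnM ?posrE ?ltr0n// => /le_trans; apply.
rewrite [X in X * _](_ : _ = s + (h + 1 + 1)); last by lra.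
rewrite mulrDl lerD//; first by near: L.
rewrite -[leRHS]expRK ler_ln ?posrE ?ltr0n ?expR_gt0//.
by have /andP[] := truncn_itv (expR_ge0 ((h + 1 + 1) * L ^+ D)).
Unshelve. all: by end_near. Qed.

Lemma entropy_bounded eps : [set: X] !=set0 -> 0 < eps ->
  exists C : R, (entropy T setT eps < C%:E)%E.
Proof.
move=> X0 eps0; have [C [C0 CP]] := ln_span_cube_growth compactX actT eps0.
exists (C + 1); apply: (@le_lt_trans _ _ C%:E); last by rewrite lte_fin ltrDl.
apply: entropy_le => //; near=> L; apply: CP => //.
Unshelve. all: by end_near. Qed.

Lemma sub_entropy K K' eps : K !=set0 -> K `<=` K' -> 0 < eps ->
  (entropy T K eps <= entropy T K' eps)%E.
Proof.
move=> K0 KK' eps0; apply: lee_lt_approx => r e /entropy_lt K'r e0.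
have K'0 : K' !=set0 by have [x /KK'] := K0; exists x.
apply: entropy_le => //; near=> L.
have L0 : 0 < L by near: L; exact: nbhs_pinfty_gt.
apply: (@le_trans _ _ (r * L ^+ D)); last first.
  by apply: ler_wpM2r; [exact/exprn_ge0/ltW|rewrite lerDl ltW].
apply: (@le_trans _ _ (ln_span T K' (cube L) eps)); last first.
  by near: L; exact: K'r.
apply: ln_span_le; apply: sub_spans KK' (@subset_refl _ _) _.
by apply: (span_cardP compactX actT) => //; exact: cube_compact.
Unshelve. all: by end_near. Qed.

End Entropy.

(** * Comparison of global and local mean dimensions *)

Section MeanDimension.
Set Implicit Arguments.
Unset Strict Implicit.
Context {R : realType} {D : nat} {X : metricType R} (T : 'rV[R]_D -> X -> X).
Hypotheses (compactX : compact [set: X]) (actT : continuous_action T).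
Variables (delta : R) (delta_gt0 : 0 < delta).

Let local_entropy (eps : R) : \bar R :=
  ereal_sup [set entropy T (dyn_ball T delta x [set: 'rV[R]_D]) eps | x in [set: X]].

(** Writing [ln (1 / eps)] as [ln 4] plus the new denominator leaves the constant
    [s + 2 + r * ln 4], which [e] times that denominator absorbs. *)
Lemma local_entropy_near (r e : R) : [set: X] !=set0 -> 0 < e ->
  \forall eps \near 0^'+, (local_entropy eps / (ln (1 / eps))%:E < r%:E)%E ->
    (entropy T setT (2 * (2 * eps)) / (ln (1 / (2 * (2 * eps))))%:E <= (r + e)%:E)%E.
Proof.
move=> X0 e0; have [s Ts] := entropy_bounded compactX actT X0 delta_gt0.
have two0 : 0 < 2 :> R by [].
near=> eps.
have eps0 : 0 < eps by near: eps; exact: nbhs_right_gt.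
have ln1 : 1 <= ln (1 / eps) by near: eps; exact: near_ln_inv_ge.
have ln_big : Num.max 1 ((s + 2 + r * ln 4) / e) <= ln (1 / (2 * (2 * eps))).
  near: eps.
  apply: (near_right0_scale (P := fun t => _ <= ln (1 / (2 * t))) two0).
  apply: (near_right0_scale (P := fun t => _ <= ln (1 / t)) two0).
  exact: near_ln_inv_ge.
have := ln_big; rewrite ge_max ler_pdivrMr// => /andP[ln2 lns].
rewrite lte_div ?(lt_le_trans ltr01)// lee_div ?(lt_le_trans ltr01)// => loc.
apply: le_trans (entropy_le_local compactX actT X0 delta_gt0 eps0 Ts
  (h := r * ln (1 / eps)) _) _.
  move=> x; apply: le_trans (ltW loc).
  by apply: ereal_sup_ubound; exists x.
have -> : ln (1 / eps) = ln 4 + ln (1 / (2 * (2 * eps))).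
  rewrite -lnM ?posrE//; last by rewrite divr_gt0// !mulr_gt0.
  by congr ln; field; rewrite gt_eqF.
by rewrite -EFinM lee_fin; lra.
Unshelve. all: by end_near. Qed.

Lemma local_entropy_le (eps : R) : 0 < eps < 1 ->
  (local_entropy eps / (ln (1 / eps))%:E <= entropy T setT eps / (ln (1 / eps))%:E)%E.
Proof.
move=> /andP[eps0 eps1].
have ln0 : 0 < ln (1 / eps) by rewrite ln_gt0// div1r invf_gt1.
rewrite lee_wpmul2r//; first by rewrite inver gt_eqF// lee_fin invr_ge0 ltW.
apply: ge_ereal_sup => _ [x _ <-]; apply: sub_entropy => //.
by exists x; rewrite dyn_ballT// => a _; rewrite mdistxx ltW.
Qed.

End MeanDimension.

Theorem theorem3p1 (R : realType) (D : nat) (X : metricType R)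
    (compactX : compact [set: X])
    (T : 'rV[R]_D -> X -> X) (actT : continuous_action T)
    (delta : R) (delta_gt0 : 0 < delta) :
  upper_mdim T =
    limf_esup (fun eps : R =>
      ereal_sup [set entropy T (dyn_ball T delta x [set: 'rV[R]_D]) eps
                | x in [set: X]] / (ln (1 / eps))%:E)%E 0^'+
  /\
  lower_mdim T =
    limf_einf (fun eps : R =>
      ereal_sup [set entropy T (dyn_ball T delta x [set: 'rV[R]_D]) eps
                | x in [set: X]] / (ln (1 / eps))%:E)%E 0^'+.
Proof.
have [X0|/set0P X0] := eqVneq [set: X] set0.
  (* On the empty space both sides are [-oo]: the spanning number is 0, and the supremum ranges over
     an empty family. *)
  suff E eps : entropy T [set: X] eps = ereal_sup [set
      entropy T (dyn_ball T delta x [set: 'rV[R]_D]) eps | x in [set: X]].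
    by split; congr (_ _ _); apply/funext => eps; rewrite E.
  rewrite X0 image_set0 ereal_sup0; apply/eqP; rewrite -leeNy_eq.
  apply: limf_esup_le; near=> L.
  have L0 : 0 < L by near: L; exact: nbhs_pinfty_gt.
  rewrite lee_div ?exprn_gt0// (_ : _ * _ = -oo)%E; last first.
    by rewrite mulNyr gtr0_sg ?exprn_gt0// mul1e.
  rewrite le0_lneNy//; apply: ereal_inf_lbound; exists fset0 => //.
have two0 : 0 < 2 :> R by [].
have local_le : \forall eps \near 0^'+,
    (ereal_sup [set entropy T (dyn_ball T delta x [set: 'rV[R]_D]) eps
       | x in [set: X]] / (ln (1 / eps))%:E <=
     entropy T setT eps / (ln (1 / eps))%:E)%E.
  near=> eps; apply: (local_entropy_le compactX actT delta_gt0).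
  apply/andP; split; near: eps; [exact: nbhs_right_gt|exact: nbhs_right_lt].
have quarter (V : set R) : (0^'+ V -> \forall eps \near 0^'+, V (2 * (2 * eps)))%R.
  move=> V0.
  apply: (near_right0_scale (P := fun t => V (2 * t)) two0).
  exact: (near_right0_scale (P := V) two0).
split; apply/eqP; rewrite eq_le; apply/andP; split.
- apply: lee_lt_approx => r e /limf_esup_lt gr e0; apply: limf_esup_le.
  (* Two rescalings replace the variable by [2 * (2 * eps)], the scale at which the global entropy
     is bounded. *)
  apply: (near_right0_unscale two0); apply: (near_right0_unscale two0).
  apply: filterS2 gr (local_entropy_near compactX actT delta_gt0 r X0 e0).
  by move=> eps gr /(_ gr).
- apply: lee_lt_approx => r e /limf_esup_lt gr e0; apply: limf_esup_le.
  apply: filterS2 gr local_le => eps gr /le_trans; apply.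
  by apply/ltW/(lt_trans gr); rewrite lte_fin ltrDl.
- apply: lee_lt_approx => r e gr e0; apply: limf_einf_le => V /quarter V0.
  have [eps [V4 near_eps] eps_r] := limf_einf_lt gr
    (filterI V0 (local_entropy_near compactX actT delta_gt0 r X0 e0)).
  by exists (2 * (2 * eps)) => //; exact: near_eps.
- apply: lee_lt_approx => r e gr e0; apply: limf_einf_le => V V0.
  have [eps [Veps le_eps] eps_r] := limf_einf_lt gr (filterI V0 local_le).
  exists eps => //; apply: le_trans le_eps _.
  by apply/ltW/(lt_trans eps_r); rewrite lte_fin ltrDl.
Unshelve. all: by end_near. Qed.
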